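(* Let $n\ge 2$, let $B$ be an open horoball in $\mathbb{H}^n$ with boundary horosphere $H=\partial B$, and let $\lambda\in(0,\lambda_1]$, where $\lambda_1=\frac{(n-1)^2}{4}$. Let $\Omega=\mathbb{H}^n\setminus\overline{B}$. Then the problem $$-\Delta u=\lambda u\ \text{ in }\Omega,\qquad u=0\ \text{ on }\partial\Omega,$$ has a positive bounded solution $u\in C(\overline{\Omega})\cap C^2(\Omega)$ that depends only on $d=\mathrm{dist}(x,H)$. This solution extends continuously to zero at $\partial_\infty\mathbb{H}^n\setminus\partial_\infty H$, and it cannot be extended continuously to $\partial_\infty H$.
   Context: $\Delta$ is the Laplace–Beltrami operator of $\mathbb{H}^n$ (curvature $-1$), and $\lambda_1=\lambda_1(\mathbb{H}^n)=\frac{(n-1)^2}{4}$. Positive means $u>0$ in $\Omega$. The compactification $\mathbb{H}^n\cup\partial_\infty\mathbb{H}^n$ carries the cone topology, and for $A\subset\mathbb{H}^n$ the asymptotic boundary $\partial_\infty A$ is the intersection of $\partial_\infty\mathbb{H}^n$ with the closure of $A$ in this compactification; $\partial_\infty H$ is a single point. *)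

(* Defs.v *)
(* Hyperbolic space H^n of curvature -1 is the Poincare ball model: the open
   unit ball of 'rV[R]_n with the metric 4 |dx|^2 / (1 - |x|^2)^2.  The ideal
   boundary is the unit sphere, the point xi standing for the class of the
   geodesic ray from the origin with direction xi, and the compactification
   is the closed unit ball with the cone topology. *)
From HB Require Import structures.
From mathcomp Require Import all_boot all_order all_algebra.
From mathcomp Require Import all_classical all_reals all_analysis.
Set Implicit Arguments.
Unset Strict Implicit.
Unset Printing Implicit Defensive.
Import Order.TTheory GRing.Theory Num.Theory.
Import numFieldNormedType.Exports.
Local Open Scope classical_set_scope.
Local Open Scope ring_scope.

Section Euclidean.
Context {R : realType} {n : nat}.
Implicit Types (x y : 'rV[R]_n) (u : 'rV[R]_n -> R) (U : set 'rV[R]_n).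

Definition dot x y : R := \sum_i x 0 i * y 0 i.

(* The library norm [`|x|] on 'rV[R]_n is the sup norm; it induces the same
   topology but not the same unit ball. *)
Definition enorm x : R := Num.sqrt (dot x x).

Definition partial (i : 'I_n) u : 'rV[R]_n -> R :=
  fun x => 'D_(delta_mx 0 i : 'rV[R]_n) u x.

(* Meant for open [U]. *)
Definition C1_on U u : Prop :=
  forall x, U x -> forall i : 'I_n,
    derivable u x (delta_mx 0 i) /\ {for x, continuous (partial i u)}.

Definition C2_on U u : Prop := C1_on U u /\ forall i, C1_on U (partial i u).

(* (det g)^(-1/2) * sum_ij d_i ((det g)^(1/2) * g^ij * d_j u) *)
Definition laplace_beltrami (g : 'rV[R]_n -> 'M[R]_n) u x : R :=
  (Num.sqrt (\det (g x)))^-1 *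
  \sum_i partial i (fun y => Num.sqrt (\det (g y)) *
                      \sum_j invmx (g y) i j * partial j u y) x.

End Euclidean.

Section Hyperbolic.
Context {R : realType} {n : nat}.
Implicit Types (x y z xi : 'rV[R]_n) (u v : 'rV[R]_n -> R).
Implicit Types (A B D H : set 'rV[R]_n).

Definition Hn : set 'rV[R]_n := [set x | enorm x < 1].

Definition ideal_boundary : set 'rV[R]_n := [set x | enorm x = 1].

Definition poincare_metric x : 'M[R]_n := ((2 / (1 - enorm x ^+ 2)) ^+ 2)%:M.

Definition hlaplacian u x : R := laplace_beltrami poincare_metric u x.

Definition arcosh (t : R) : R := ln (t + Num.sqrt (t ^+ 2 - 1)).

(* Closed form of the distance of [poincare_metric]. *)
Definition hdist x y : R :=
  arcosh (1 + 2 * enorm (x - y) ^+ 2 /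
              ((1 - enorm x ^+ 2) * (1 - enorm y ^+ 2))).

Definition hdist_set x A : R := inf [set hdist x y | y in A].

(* Closure and boundary relative to H^n, which is open in 'rV[R]_n. *)
Definition hclosure A : set 'rV[R]_n := closure A `&` Hn.

Definition hboundary A : set 'rV[R]_n := hclosure A `\` interior A.

(* Unit speed geodesic ray from the origin to the ideal point [xi]: the
   coefficient is tanh (t / 2). *)
Definition geodesic_ray xi (t : R) : 'rV[R]_n :=
  ((expR t - 1) / (expR t + 1)) *: xi.

Definition busemann xi x : R :=
  lim ((hdist x (geodesic_ray xi t) - t) @[t --> +oo]).

Definition is_open_horoball B : Prop :=
  exists xi (c : R), ideal_boundary xi /\
    B = [set x | Hn x /\ busemann xi x < c].

(* Angle at the origin between the geodesics to [x] and [y], each in H^n or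
   ideal; the model is conformal, so it is the Euclidean angle. *)
Definition angle0 x y : R := acos (dot x y / (enorm x * enorm y)).

(* Truncated cone around [xi] with vertex at the origin. *)
Definition truncated_cone xi (theta r : R) : set 'rV[R]_n :=
  [set z | angle0 z xi < theta /\
           (ideal_boundary z \/ (Hn z /\ r < hdist 0 z))].

(* Neighbourhoods of the cone topology at the points of the closed ball. *)
Definition cone_nbhs z : set_system 'rV[R]_n :=
  [set U | if enorm z < 1 then nbhs z U
           else exists theta r : R,
                  [/\ 0 < theta, 0 < r & truncated_cone z theta r `<=` U]].

Definition asymptotic_boundary A : set 'rV[R]_n :=
  [set xi | ideal_boundary xi /\
            forall U, cone_nbhs xi U -> A `&` U !=set0].

(* Continuity on a subset [D] of the compactification. *)
Definition cone_continuous_on D v : Prop :=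
  forall z, D z -> v @ within D (cone_nbhs z) --> v z.

End Hyperbolic.

Arguments Hn : clear implicits.
Arguments ideal_boundary : clear implicits.

Definition lambda1 (R : realType) (n : nat) : R := (n%:R - 1) ^+ 2 / 4.

(* Main.v *)
Require Import Defs.
From HB Require Import structures.
From mathcomp Require Import all_boot all_order all_algebra.
From mathcomp Require Import ring lra.
From mathcomp Require Import all_classical all_reals all_analysis.
Set Implicit Arguments.
Unset Strict Implicit.
Unset Printing Implicit Defensive.
Import Order.TTheory GRing.Theory Num.Theory.
Import numFieldNormedType.Exports.
Local Open Scope classical_set_scope.
Local Open Scope ring_scope.

(** Let xi be the ideal centre of the horoball, b its Busemann function and
    {b < c} the horoball. In the ball model b = - ln P with
    P(x) = (1 - |x|^2) / |x - xi|^2. On the exterior {b > c} the distance to the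
    horosphere {b = c} is b - c ([hdist_horosphere]): inversion in a sphere
    around xi turns horospheres into parallel hyperplanes, the inequality
    dist(x, y) >= b(x) - b(y) into the Cauchy-Schwarz inequality, and the normal
    of the hyperplanes through x gives the nearest point.

    The function b has gradient of norm 1 and Laplacian n - 1
    ([norm_grad_busemann], [laplace_busemann]), so u = f(b - c) solves the
    equation as soon as f'' + (n - 1) f' + lam f = 0 ([hlaplacian_radial]). The
    condition 0 < lam <= (n - 1)^2 / 4 says that the characteristic roots are
    real and negative. Hence there is a solution f with f(0) = 0, positive on
    the positive half-line and exponentially decaying ([radial_profile]), which
    makes u positive, bounded and zero on the horosphere.

    On the closed ball the cone topology is the Euclidean topology
    ([within_cone_nbhs]). At an ideal point different from xi the function P is
    continuous with value 0, that is b tends to infinity, and u tends to 0.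
    On the other hand every level set of b, being an unbounded hyperplane after
    inversion, accumulates at xi ([horosphere_near_center]). So every value
    taken by f on the positive half-line is a limit value of u at xi, and these
    values are not all equal because f is positive and tends to 0. *)

(** * The Euclidean scalar product *)

Section DotTheory.
Context {R : realType} {n : nat}.
Implicit Types (x y z v : 'rV[R]_n) (U : set 'rV[R]_n).

Lemma dotC x y : dot x y = dot y x.
Proof. by apply: eq_bigr => i _; rewrite mulrC. Qed.

Lemma dotDl x y z : dot (x + y) z = dot x z + dot y z.
Proof. by rewrite -big_split; apply: eq_bigr => i _; rewrite mxE mulrDl. Qed.

Lemma dotZl a x y : dot (a *: x) y = a * dot x y.
Proof. by rewrite mulr_sumr; apply: eq_bigr => i _; rewrite mxE mulrA. Qed.

Lemma dotNl x y : dot (- x) y = - dot x y.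
Proof. by rewrite -scaleN1r dotZl mulN1r. Qed.

Lemma dotDr x y z : dot x (y + z) = dot x y + dot x z.
Proof. by rewrite ![dot x _]dotC dotDl. Qed.

Lemma dotZr a x y : dot x (a *: y) = a * dot x y.
Proof. by rewrite ![dot x _]dotC dotZl. Qed.

Lemma dotNr x y : dot x (- y) = - dot x y.
Proof. by rewrite ![dot x _]dotC dotNl. Qed.

Definition dotE := (dotDl, dotDr, dotZl, dotZr, dotNl, dotNr).

Lemma dot0l x : dot 0 x = 0.
Proof. by rewrite -(scale0r 0) dotZl mul0r. Qed.

Lemma sqr_dist_scale a x y :
  dot (x - a *: y) (x - a *: y) = dot x x - 2 * a * dot x y + a ^+ 2 * dot y y.
Proof. by rewrite !dotE (dotC y x); ring. Qed.

Lemma sqr_dot_comb a b x y :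
  dot (a *: x + b *: y) (a *: x + b *: y) =
  a ^+ 2 * dot x x + 2 * a * b * dot x y + b ^+ 2 * dot y y.
Proof. by rewrite !dotE (dotC y x); ring. Qed.

Lemma dot_delta x i : dot x (delta_mx 0 i) = x 0 i.
Proof.
rewrite /dot (bigD1 i) //= mxE !eqxx mulr1 big1 ?addr0// => j ji.
by rewrite mxE (negPf ji) andbF mulr0.
Qed.

Lemma dot_ge0 x : 0 <= dot x x.
Proof. by apply: sumr_ge0 => i _; rewrite -expr2 sqr_ge0. Qed.

Lemma sqr_coord_le_dot x i : x 0 i ^+ 2 <= dot x x.
Proof.
rewrite /dot (bigD1 i) //= -expr2 lerDl sumr_ge0// => j _.
by rewrite -expr2 sqr_ge0.
Qed.

Lemma dot_eq0 x : (dot x x == 0) = (x == 0).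
Proof.
apply/eqP/eqP => [x0|->]; last by rewrite dot0l.
apply/rowP => i; apply/eqP; rewrite mxE -sqrf_eq0 eq_le sqr_ge0 andbT.
by rewrite -x0 sqr_coord_le_dot.
Qed.

Lemma dot_gt0 x : (0 < dot x x) = (x != 0).
Proof. by rewrite lt_def dot_eq0 dot_ge0 andbT. Qed.

(** The square norm of |y|^2 x - <x, y> y is |y|^2 times the difference of the
    two sides. *)
Lemma cauchy_schwarz x y : dot x y ^+ 2 <= dot x x * dot y y.
Proof.
have [->|y0] := eqVneq y 0; first by rewrite dotC !dot0l expr0n mulr0.
rewrite -dot_gt0 in y0; have := dot_ge0 (dot y y *: x - dot x y *: y).
rewrite !dotE (dotC y x) => h; rewrite -subr_ge0 -(pmulr_rge0 _ y0).
by apply: le_trans h _; rewrite le_eqVlt; apply/orP; left; apply/eqP; ring.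
Qed.

Lemma sqr_enorm x : enorm x ^+ 2 = dot x x.
Proof. by rewrite sqr_sqrtr ?dot_ge0. Qed.

Lemma enorm_ge0 x : 0 <= enorm x.
Proof. exact: sqrtr_ge0. Qed.

Lemma HnE x : Hn R n x <-> dot x x < 1.
Proof.
rewrite /Hn /= -(@ltr_pXn2r _ 2) ?nnegrE ?enorm_ge0// sqr_enorm expr1n.
by [].
Qed.

Lemma ideal_boundaryE x : ideal_boundary R n x <-> dot x x = 1.
Proof.
rewrite /ideal_boundary /= -sqr_enorm; split => [->|/eqP]; rewrite ?expr1n//.
by rewrite sqrf_eq1 => /orP[/eqP//|/eqP xN1]; have := enorm_ge0 x; lra.
Qed.

Lemma sqr_dist_ideal xi x : dot xi xi = 1 ->
  dot (x - xi) (x - xi) = dot x x + 1 - 2 * dot x xi.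
Proof. by move=> xi1; rewrite !dotE xi1 (dotC xi); ring. Qed.

Lemma continuous_coord (i : 'I_n) x : {for x, continuous (fun y => y 0 i)}.
Proof. exact: coord_continuous. Qed.

Lemma continuous_dot x : {for x, continuous (fun y => dot y y)}.
Proof.
apply: (cvg_big (F := nbhs x) (@add_continuous R)) => i _.
by apply: (cvgM (F := nbhs x)); exact: continuous_coord.
Qed.

Lemma continuous_dotr z x : {for x, continuous (fun y => dot y z)}.
Proof.
apply: (cvg_big (F := nbhs x) (@add_continuous R)) => i _.
by apply: (cvgM (F := nbhs x)); [exact: continuous_coord|exact: cvg_cst].
Qed.

Lemma continuous_sqr_dist a x :
  {for x, continuous (fun y => dot (y - a) (y - a))}.
Proof.
have -> : (fun y => dot (y - a) (y - a)) =
    (fun y => dot y y + dot a a - dot y (2 *: a)).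
  by apply: funext => y; rewrite !dotE (dotC a); ring.
apply: continuousB; last exact: continuous_dotr.
by apply: continuousD; [exact: continuous_dot|exact: cst_continuous].
Qed.

(** Entries are controlled by the Euclidean norm, and the Euclidean norm is
    continuous: hence the product topology is the Euclidean one. *)
Lemma nbhs_dotP z U :
  nbhs z U <-> exists2 e : R, 0 < e & forall w, dot (w - z) (w - z) < e -> U w.
Proof.
split => [/nbhs_ballP[e /= e0 eU]|[e e0 eU]].
  exists (e ^+ 2); first by rewrite exprn_gt0.
  move=> w we; apply: eU; split => // i j; rewrite (ord1 i) /ball /= distrC.
  rewrite -(gtr0_norm e0) -ltr_sqr ?nnegrE// !real_normK ?num_real//.
  apply: le_lt_trans we; have := sqr_coord_le_dot (w - z) j.
  by rewrite !mxE.
have := @continuous_sqr_dist z z.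
rewrite /prop_for /continuous_at subrr dot0l => h.
by apply: filterS (cvgr_lt _ h _ e0).
Qed.

Lemma open_Hn : open (Hn R n).
Proof.
rewrite openE => x /HnE x1; rewrite /interior.
by apply: filterS (cvgr_lt _ (@continuous_dot x) _ x1) => y ?; apply/HnE.
Qed.

End DotTheory.

(** * The closed ball as the compactification *)

Section Arcosh.
Context {R : realType}.
Implicit Types (a r s t : R).

Lemma ler_arcosh s t : 1 <= s -> s <= t -> arcosh s <= arcosh t.
Proof.
move=> s1 st; rewrite ler_ln ?posrE; first last.
- by rewrite ltr_wpDr ?sqrtr_ge0//; lra.
- by rewrite ltr_wpDr ?sqrtr_ge0//; lra.
by rewrite lerD// ler_wsqrtr// lerB// ler_sqr// nnegrE; lra.
Qed.

Lemma arcosh_cosh a : 0 <= a -> arcosh ((expR a + expR (- a)) / 2) = a.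
Proof.
move=> a0; have ea := expR_gt0 a; have ena := expR_gt0 (- a).
have eM : expR a * expR (- a) = 1 by rewrite expRxMexpNx_1.
have -> : arcosh ((expR a + expR (- a)) / 2) = ln (expR a); last exact: expRK.
congr ln; have -> : ((expR a + expR (- a)) / 2) ^+ 2 - 1 =
    ((expR a - expR (- a)) / 2) ^+ 2 by rewrite -[X in _ - X]eM; field.
rewrite sqrtr_sqr ger0_norm; first by field.
by rewrite divr_ge0// subr_ge0 ler_expR; lra.
Qed.

Lemma arcosh_ln_ratio s t : 0 < s -> s <= t ->
  arcosh ((t / s + s / t) / 2) = ln (t / s).
Proof.
move=> s0 st; have t0 := lt_le_trans s0 st.
rewrite -[RHS]arcosh_cosh; last by rewrite ln_ge0// ler_pdivlMr// mul1r.
by rewrite expRN lnK ?posrE ?divr_gt0// invf_div.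
Qed.

Lemma half_ratio_ge1 s t : 0 < s -> 0 < t -> 1 <= (t / s + s / t) / 2.
Proof.
move=> s0 t0; rewrite -subr_ge0.
have -> : (t / s + s / t) / 2 - 1 = (t - s) ^+ 2 / (2 * (s * t)).
  by field; rewrite !lt0r_neq0.
by rewrite divr_ge0 ?sqr_ge0// !mulr_ge0// ltW.
Qed.

Lemma lt_arcosh r t : expR r < t -> r < arcosh t.
Proof.
move=> rt; have t0 := lt_trans (expR_gt0 r) rt; rewrite -[ltLHS]expRK.
rewrite ltr_ln ?posrE ?expR_gt0 ?ltr_wpDr ?sqrtr_ge0//.
Qed.

Lemma arcosh_lt r t : 1 <= t -> r < arcosh t -> expR r < 2 * t.
Proof.
move=> t1; rewrite -ltr_expR lnK => [|]; last first.
  by rewrite posrE ltr_wpDr ?sqrtr_ge0//; lra.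
move/lt_le_trans; apply; rewrite mulr2n mulrDl !mul1r lerD2l.
rewrite -[leRHS]gtr0_norm -?sqrtr_sqr; last by lra.
by rewrite ler_wsqrtr//; lra.
Qed.

End Arcosh.

Section ConeTopology.
Context {R : realType} {n : nat}.
Implicit Types (w x y z : 'rV[R]_n) (A D U : set 'rV[R]_n).

Lemma hdistE x y : hdist x y =
  arcosh (1 + 2 * dot (x - y) (x - y) / ((1 - dot x x) * (1 - dot y y))).
Proof. by rewrite /hdist !sqr_enorm. Qed.

Lemma hdist0E x : dot x x < 1 ->
  hdist 0 x = arcosh ((1 + dot x x) / (1 - dot x x)).
Proof.
move=> x1; rewrite hdistE sub0r dotNl dotNr opprK dot0l; congr arcosh.
by field; lra.
Qed.

Lemma cos_angle0_itv w z : -1 <= dot w z / (enorm w * enorm z) <= 1.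
Proof.
rewrite -ler_norml -sqrtr_sqr -(sqrtr1 R) ler_wsqrtr//.
rewrite exprMn exprVn exprMn !sqr_enorm.
have [->|h] := eqVneq (dot w w * dot z z) 0; first by rewrite invr0 mulr0.
by rewrite ler_pdivrMr ?mul1r ?cauchy_schwarz// lt_def h mulr_ge0 ?dot_ge0.
Qed.

Lemma angle0_lt w z theta : 0 < theta <= pi ->
  (angle0 w z < theta) = (cos theta < dot w z / (enorm w * enorm z)).
Proof.
move=> /andP[t0 tpi]; rewrite -[in RHS](acosK (x := dot w z / _)); last first.
  by rewrite in_itv /= cos_angle0_itv.
rewrite ltr_cos// in_itv /=; last by rewrite ltW.
by rewrite acos_ge0 ?acos_lepi// cos_angle0_itv.
Qed.

(** A truncated cone of small angle and large radius is close to its ideal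
    vertex: with [t] the cosine of the angle and [w] in the closed ball,
    |w - z|^2 = (1 - |w|)^2 + 2|w|(1 - t). *)
Lemma truncated_cone_small z (e : R) : ideal_boundary R n z -> 0 < e ->
  exists theta r : R, [/\ 0 < theta, 0 < r &
    forall w, truncated_cone z theta r w -> dot (w - z) (w - z) < e].
Proof.
move=> /ideal_boundaryE z1 e0.
pose d := Num.min (e / 4) 1; have d0 : 0 < d by rewrite lt_min ltr01 divr_gt0.
have de : d <= e / 4 by rewrite ge_min lexx.
have d1 : d <= 1 by rewrite ge_min lexx orbT.
have th0 : 0 < acos (1 - d) by apply: acos_gt0; lra.
have nz1 : enorm z = 1 by rewrite /enorm z1 sqrtr1.
(* Both terms of the formula are below e / 2: the angle gives 1 - t < d, and
   the radius r gives 4 / (1 - |w|^2) > exp r > 8 / e. *)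
exists (acos (1 - d)), (Num.max 1 (8 / e)).
split => //; first by rewrite lt_max ltr01.
move=> w [].
rewrite angle0_lt; last by rewrite th0 acos_lepi//; lra.
rewrite acosK; last by rewrite in_itv /=; lra.
have := cos_angle0_itv w z; set t := dot w z / _ => /andP[tN1 t1] dt far.
have wzE : dot w z = enorm w * t.
  rewrite /t nz1 mulr1; have [w0|w0] := eqVneq (enorm w) 0.
    apply/eqP; rewrite w0 mul0r -sqrf_eq0 eq_le sqr_ge0 andbT.
    apply: le_trans (cauchy_schwarz w z) _.
    by rewrite -sqr_enorm w0 expr0n mul0r.
  by field.
have w0 := enorm_ge0 w.
have wE : dot (w - z) (w - z) = (1 - enorm w) ^+ 2 + 2 * enorm w * (1 - t).
  by rewrite !dotE (dotC z) z1 wzE -sqr_enorm; ring.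
have [w1 wfar] : enorm w <= 1 /\ (1 - enorm w) ^+ 2 < e / 2.
  case: far => [|[]].
    rewrite /ideal_boundary /= => ->; rewrite lexx subrr expr0n.
    by rewrite divr_gt0.
  move=> w1 rw; split; first exact: ltW.
  have ww1 : dot w w < 1 by apply/HnE.
  have /arcosh_lt: 1 <= (1 + dot w w) / (1 - dot w w).
    by rewrite ler_pdivlMr; have := dot_ge0 w; lra.
  move: rw; rewrite hdist0E// => rw /(_ _ rw) erw.
  have rr : 8 / e < 4 / (1 - dot w w).
    apply: le_lt_trans (lt_le_trans erw _).
      apply: le_trans (_ : Num.max 1 (8 / e) <= _).
        by rewrite le_max lexx orbT.
      by apply: le_trans (expR_ge1Dx _); lra.
    by rewrite mulrA ler_pM2r ?invr_gt0; lra.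
  move: rr; rewrite ltr_pdivlMr; last by lra.
  rewrite mulrAC ltr_pdivrMr// -sqr_enorm => rr.
  by move: w1; rewrite /Hn /=; nra.
rewrite wE; have : 2 * enorm w * (1 - t) <= 2 * (1 - t) by nra.
by lra.
Qed.

(** Conversely every point of the closed ball close to [z] lies in the cone:
    the cosine of its angle tends to 1 and its distance to 0 tends to
    infinity. *)
Lemma nbhs_truncated_cone z theta r :
  ideal_boundary R n z -> 0 < theta -> 0 < r ->
  nbhs z [set w | dot w w <= 1 -> truncated_cone z theta r w].
Proof.
move=> /ideal_boundaryE z1 t0 r0.
have nz1 : enorm z = 1 by rewrite /enorm z1 sqrtr1.
pose th := Num.min theta pi.
have th0 : 0 < th by rewrite lt_min t0 pi_gt0.
have thpi : th <= pi by rewrite ge_min lexx orbT.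
have cth : cos th < dot z z.
  by rewrite z1 -cos0 ltr_cos// in_itv /= ?lexx ?pi_ge0// ltW.
have near1 := cvgr_gt _ (@continuous_dotr _ _ z z) _ cth.
have er := expR_gt0 r.
have near2 : \forall w \near z, (expR r - 1) / (expR r + 1) < dot w w.
  apply: (cvgr_gt _ (@continuous_dot _ _ z)).
  by rewrite z1 ltr_pdivrMr; lra.
have near3 : \forall w \near z, 0 < dot w z.
  by apply: (cvgr_gt _ (@continuous_dotr _ _ z z)); rewrite z1.
near=> w => /= w1.
have wz : 0 < dot w z by near: w; exact: near3.
have cw : cos th < dot w z by near: w; exact: near1.
have rw : (expR r - 1) / (expR r + 1) < dot w w by near: w; exact: near2.
have nw1 : enorm w <= 1 by rewrite -(sqrtr1 R) ler_wsqrtr.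
have nw0 : 0 < enorm w.
  rewrite lt_def enorm_ge0 andbT -sqrf_eq0 sqr_enorm dot_eq0.
  by apply: contraTneq wz => ->; rewrite dot0l ltxx.
split.
  apply: (@lt_le_trans _ _ th); last by rewrite ge_min lexx.
  rewrite angle0_lt ?th0// nz1 mulr1 (lt_le_trans cw)//.
  by rewrite ler_pdivlMr// ler_piMr// ltW.
move: w1; rewrite le_eqVlt => /orP[/eqP w1|w1].
  by left; apply/ideal_boundaryE.
right; split; first exact/HnE.
rewrite hdist0E//; apply: lt_arcosh; rewrite ltr_pdivlMr; last by lra.
by move: rw; rewrite ltr_pdivrMr; lra.
Unshelve. all: by end_near. Qed.

(** On the closed ball the cone topology is the Euclidean one, at ideal points
    as well as inside. *)
Lemma within_cone_nbhs D z : dot z z <= 1 -> (forall w, D w -> dot w w <= 1) ->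
  within D (cone_nbhs z) = within D (nbhs z).
Proof.
move=> zle1 D1; apply/predeqP => A; rewrite /within /cone_nbhs /=.
move: zle1; rewrite le_eqVlt => /orP[/eqP z1|zlt1]; last first.
  by have : Hn R n z by [apply/HnE]; rewrite /Hn /= => ->.
have -> : (enorm z < 1) = false by rewrite /enorm z1 sqrtr1 ltxx.
have zi : ideal_boundary R n z by apply/ideal_boundaryE.
split => [[theta [r [t0 r0 sub]]]|/nbhs_dotP[e e0 sub]].
  apply: filterS (nbhs_truncated_cone zi t0 r0) => w h Dw.
  exact: (sub w (h (D1 _ Dw))).
have [theta [r [t0 r0 small]]] := truncated_cone_small zi e0.
by exists theta, r; split => // w /small /sub.
Qed.

Lemma cone_nbhs_closed_ball z U : dot z z <= 1 -> cone_nbhs z U ->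
  nbhs z [set w | dot w w <= 1 -> U w].
Proof.
move=> z1 zU.
have := @within_cone_nbhs [set w | dot w w <= 1] z z1 (fun=> id).
move/predeqP/(_ U) => [+ _]; apply; move: zU; rewrite /within /cone_nbhs /=.
case: ifP => _; first by apply: filterS => w Uw _.
by move=> [theta [r [t0 r0 sub]]]; exists theta, r; split=> // w /sub Uw _.
Qed.

End ConeTopology.

(** * Horospheres *)

(** The power [n - 1] of this function is the Poisson kernel of hyperbolic
    space; its level sets are the horospheres centred at [xi]. *)
Definition poisson {R : realType} {n : nat} (xi x : 'rV[R]_n) : R :=
  (1 - dot x x) / dot (x - xi) (x - xi).

(** Inversion in the unit sphere around [xi]: it turns the ball into a
    half-space and the horospheres centred at [xi] into hyperplanes
    orthogonal to [xi]. *)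
Definition inversion {R : realType} {n : nat} (xi v : 'rV[R]_n) : 'rV[R]_n :=
  xi + (dot v v)^-1 *: v.

Section Horospheres.
Context {R : realType} {n : nat}.
Context {xi : 'rV[R]_n} (xi1 : dot xi xi = 1).
Implicit Types (x y v : 'rV[R]_n) (k c : R).

Lemma sqr_dist_xi_gt0 x : dot x x < 1 -> 0 < dot (x - xi) (x - xi).
Proof.
by rewrite dot_gt0 subr_eq0; apply: contraTneq => ->; rewrite xi1 ltxx.
Qed.

Lemma poisson_gt0 x : dot x x < 1 -> 0 < poisson xi x.
Proof. by move=> x1; rewrite divr_gt0 ?sqr_dist_xi_gt0// subr_gt0. Qed.

(** With q = exp (- t), the ray is at (1 - q)/(1 + q) xi, and q times the
    hyperbolic cosine of the distance from [x] is a polynomial in q whose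
    constant term is 1 / (2 P(x)). *)
Lemma busemannE x : dot x x < 1 -> busemann xi x = - ln (poisson xi x).
Proof.
move=> x1; have p0 := sqr_dist_xi_gt0 x1; have P0 := poisson_gt0 x1.
pose a := dot (x - xi) (x - xi) / (2 * (1 - dot x x)).
pose b := (dot x x + 1 + 2 * dot x xi) / (2 * (1 - dot x x)).
have a0 : 0 < a by rewrite divr_gt0//; lra.
pose w (t : R) := a + b * (expR (- t) * expR (- t)).
have e0 : expR (- t) @[t --> +oo] --> (0 : R) by exact: cvgr_expR.
have wa : w t @[t --> +oo] --> a.
  rewrite -[X in _ --> X]addr0 -(mulr0 b) -[X in b * X](mulr0 0).
  by apply: cvgD; [exact: cvg_cst|apply: cvgM; [exact: cvg_cst|exact: cvgM]].
have lima : ln (w t + Num.sqrt (w t ^+ 2 - expR (- t) ^+ 2)) @[t --> +oo]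
    --> - ln (poisson xi x).
  have -> : - ln (poisson xi x) = ln (a + Num.sqrt (a ^+ 2 - 0 ^+ 2)).
    rewrite expr0n subr0 sqrtr_sqr gtr0_norm// -lnV ?posrE//; congr ln.
    rewrite /poisson /a; field.
    by apply/andP; split; lra.
  apply: (@continuous_cvg _ R R _ _ _ (@ln R)).
    by apply: continuous_ln; rewrite ltr_wpDr ?sqrtr_ge0.
  apply: cvgD => //; apply: (@continuous_cvg _ R R _ _ _ Num.sqrt).
    exact: sqrt_continuous.
  by apply: cvgB; rewrite !expr2; apply: cvgM.
apply: cvg_lim => //; apply: cvg_trans lima; apply: near_eq_cvg.
near=> t.
have w0 : 0 < w t by near: t; exact: (cvgr_gt _ wa).
have -> : hdist x (geodesic_ray xi t) - t =
    ln (expR (- t)) + hdist x (geodesic_ray xi t) by rewrite expRK addrC.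
set e := expR (- t); have e_gt0 : 0 < e by exact: expR_gt0.
have tE : expR t = e^-1 by rewrite /e expRN invrK.
set T := 1 + 2 * dot (x - geodesic_ray xi t) (x - geodesic_ray xi t) /
  ((1 - dot x x) * (1 - dot (geodesic_ray xi t) (geodesic_ray xi t))).
have TE : w t = e * T.
  rewrite /T /geodesic_ray !dotE (dotC xi) xi1 tE /w -/e /a /b.
  rewrite sqr_dist_ideal//.
  field.
  by rewrite !lt0r_neq0 ?mulr_gt0 //; lra.
rewrite hdistE -/T /arcosh -lnM ?posrE//; last first.
  by rewrite ltr_wpDr ?sqrtr_ge0// -(pmulr_rgt0 _ e_gt0) -TE.
rewrite mulrDr TE exprMn -[X in _ - X]mulr1 -mulrBr sqrtrM ?sqr_ge0//.
by rewrite sqrtr_sqr gtr0_norm.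
Unshelve. all: by end_near. Qed.

(** The key estimate behind the 1-Lipschitz property of the Busemann function:
    after inversion it is the Cauchy-Schwarz inequality between the difference
    of the two points and [xi], and so it is an equality along the normals of
    the horospheres. *)
Lemma sqr_dist_ge_poisson x y :
  (dot (x - xi) (x - xi) * (1 - dot y y) -
   dot (y - xi) (y - xi) * (1 - dot x x)) ^+ 2 <=
  4 * (dot (x - xi) (x - xi) * dot (y - xi) (y - xi)) * dot (x - y) (x - y).
Proof.
set p := dot (x - xi) _; set q := dot (y - xi) _.
pose z : 'rV[R]_n := q *: (x - xi) - p *: (y - xi).
have zxi : dot z xi = (p * (1 - dot y y) - q * (1 - dot x x)) / 2.
  by rewrite /z /p /q !sqr_dist_ideal// !dotE xi1; field.
have zz : dot z z = p * q * dot (x - y) (x - y).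
  rewrite /z !dotE (dotC y x) !(dotC xi) xi1 /p /q !sqr_dist_ideal//; ring.
have := cauchy_schwarz z xi; rewrite xi1 mulr1 zxi zz.
by rewrite exprMn exprVn ler_pdivrMr//; lra.
Qed.

Lemma hdist_ge_busemann x y : dot x x < 1 -> dot y y < 1 ->
  poisson xi x <= poisson xi y ->
  ln (poisson xi y / poisson xi x) <= hdist x y.
Proof.
move=> x1 y1 Pxy; have Px := poisson_gt0 x1; have Py := poisson_gt0 y1.
rewrite hdistE -arcosh_ln_ratio//; apply: ler_arcosh.
  exact: half_ratio_ge1.
have p0 := sqr_dist_xi_gt0 x1; have q0 := sqr_dist_xi_gt0 y1.
have := sqr_dist_ge_poisson x y; rewrite /poisson.
set p := dot (x - xi) _ in p0 *; set q := dot (y - xi) _ in q0 *.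
set s := 1 - dot x x; set t := 1 - dot y y => key.
have s0 : 0 < s by rewrite subr_gt0.
have t0 : 0 < t by rewrite subr_gt0.
rewrite -subr_ge0.
set d := dot (x - y) _ in key *.
have -> : 1 + 2 * d / (s * t) - (t / q / (s / p) + s / p / (t / q)) / 2 =
    (4 * (p * q) * d - (p * t - q * s) ^+ 2) / (2 * (p * q) * (s * t)).
  by field; rewrite !lt0r_neq0.
by rewrite divr_ge0 ?subr_ge0// !mulr_ge0// ltW.
Qed.

Lemma sqr_dist_inversion v :
  dot (inversion xi v - xi) (inversion xi v - xi) = (dot v v)^-1.
Proof.
rewrite /inversion addrC addKr !dotE.
by have [->|v0] := eqVneq (dot v v) 0; [rewrite invr0 mul0r|field].
Qed.

(** The level set [k] of [poisson] is the hyperplane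
    <v, xi> = - (1 + k) / 2 after inversion. *)
Lemma poisson_inversion v k : 0 < k -> dot v xi = - (1 + k) / 2 ->
  dot (inversion xi v) (inversion xi v) < 1 /\ poisson xi (inversion xi v) = k.
Proof.
move=> k0 vxi; have v0 : 0 < dot v v.
  rewrite dot_gt0; apply: contra_eq_neq vxi => ->; rewrite dot0l.
  by rewrite eq_sym mulf_neq0// oppr_eq0; lra.
have sE : 1 - dot (inversion xi v) (inversion xi v) = k / dot v v.
  rewrite /inversion !dotE xi1 (dotC xi) vxi; field.
  exact: lt0r_neq0.
split; first by rewrite -subr_gt0 sE divr_gt0.
by rewrite /poisson sE sqr_dist_inversion; field; exact: lt0r_neq0.
Qed.

(** The nearest point of a horosphere is on the geodesic through [xi], that is
    on the normal of the hyperplane after inversion. *)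
Lemma horosphere_foot x k : dot x x < 1 -> poisson xi x <= k ->
  exists y, [/\ dot y y < 1, poisson xi y = k &
                hdist x y = ln (k / poisson xi x)].
Proof.
move=> x1 Pk; have P0 := poisson_gt0 x1; have k0 := lt_le_trans P0 Pk.
have := sqr_dist_xi_gt0 x1.
have xxi : dot x xi = (dot x x + 1 - dot (x - xi) (x - xi)) / 2.
  by rewrite sqr_dist_ideal//; field.
have PE : poisson xi x = (1 - dot x x) / dot (x - xi) (x - xi) by [].
move: xxi PE; set p := dot (x - xi) _ => xxi PE p0.
(* After inversion [x] is at height - (1 + P(x)) / 2 along [xi]; moving by [m]
   along [xi] reaches the hyperplane of the horosphere of level [k]. *)
pose m := (poisson xi x - k) / 2.
pose v := p^-1 *: (x - xi) + m *: xi.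
have vxi : dot v xi = - (1 + k) / 2.
  rewrite /v /m dotDl !dotZl dotDl dotNl xi1 xxi PE; field.
  exact: lt0r_neq0.
have [y1 Py] := poisson_inversion k0 vxi.
exists (inversion xi v); split => //.
rewrite hdistE -arcosh_ln_ratio//; congr arcosh.
have v0 : 0 < dot v v.
  by rewrite -invr_gt0 -sqr_dist_inversion sqr_dist_xi_gt0.
have sE : 1 - dot (inversion xi v) (inversion xi v) = k / dot v v.
  rewrite -[in LHS](mulrK (x := dot v v) _ (1 - _)) ?unitfE ?lt0r_neq0//.
  by congr (_ / _); rewrite -Py /poisson sqr_dist_inversion invrK.
have dE : dot (x - inversion xi v) (x - inversion xi v) = m ^+ 2 * p / dot v v.
  have vl w : dot v w = p^-1 * dot (x - xi) w + m * dot xi w.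
    by rewrite [LHS]dotDl !dotZl.
  have vE : dot v v = p^-1 + 2 * m * dot (x - xi) xi / p + m ^+ 2.
    rewrite vl (dotC _ v) (dotC _ v) !vl -/p xi1 (dotC xi); field.
    exact: lt0r_neq0.
  rewrite (_ : x - _ = (x - xi) - (dot v v)^-1 *: v); last first.
    by rewrite /inversion opprD addrA.
  have -> : dot ((x - xi) - (dot v v)^-1 *: v) ((x - xi) - (dot v v)^-1 *: v) =
      p - 2 / dot v v * dot (x - xi) v + (dot v v)^-1.
    by rewrite sqr_dist_scale -/p; field; exact: lt0r_neq0.
  have -> : dot (x - xi) v = 1 + m * dot (x - xi) xi.
    by rewrite dotC vl -/p mulVf ?lt0r_neq0// (dotC xi).
  rewrite -(mulrK (x := dot v v) _ (p - _ + _)) ?unitfE ?lt0r_neq0//.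
  congr (_ / _).
  transitivity (p * dot v v - 2 * (1 + m * dot (x - xi) xi) + 1).
    by field; exact: lt0r_neq0.
  by rewrite vE; field; exact: lt0r_neq0.
rewrite sE dE /m PE; field.
rewrite !lt0r_neq0//; last by rewrite subr_gt0.
Qed.

(** The distance to a horosphere is the difference of the Busemann functions:
    the Lipschitz bound is attained at the foot. *)
Lemma hdist_horosphere x k : dot x x < 1 -> poisson xi x <= k ->
  hdist_set x [set y | Hn R n y /\ poisson xi y = k] =
  ln k - ln (poisson xi x).
Proof.
move=> x1 Pk; have P0 := poisson_gt0 x1; have k0 := lt_le_trans P0 Pk.
rewrite -ln_div ?posrE//.
have [y [y1 Py dxy]] := horosphere_foot x1 Pk.
have mem : [set hdist x z | z in [set z | Hn R n z /\ poisson xi z = k]]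
    (ln (k / poisson xi x)).
  by exists y => //; split => //; apply/HnE.
have lb : lbound [set hdist x z | z in [set z | Hn R n z /\ poisson xi z = k]]
    (ln (k / poisson xi x)).
  move=> _ [z [/HnE z1 Pz] <-]; rewrite -Pz; apply: hdist_ge_busemann => //.
  by rewrite Pz.
apply/eqP; rewrite eq_le; apply/andP; split.
  by apply: ge_inf mem; exists (ln (k / poisson xi x)).
by apply: lb_le_inf lb; exists (ln (k / poisson xi x)).
Qed.

End Horospheres.

Section Horoballs.
Context {R : realType} {n : nat} {xi : 'rV[R]_n} (xi1 : dot xi xi = 1).
Implicit Types (x y v : 'rV[R]_n) (k : R).

Lemma continuous_poisson x : x != xi -> {for x, continuous (poisson xi)}.
Proof.
rewrite -subr_eq0 -dot_eq0 => x0.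
apply: continuousM.
  by apply: continuousB; [exact: cst_continuous|exact: continuous_dot].
by apply: continuousV => //; exact: continuous_sqr_dist.
Qed.

Lemma Hn_neq_ideal x : Hn R n x -> x != xi.
Proof. by move=> /HnE x1; apply: contraTneq x1 => ->; rewrite xi1 ltxx. Qed.

Lemma open_poisson_gt k : open [set x | Hn R n x /\ k < poisson xi x].
Proof.
rewrite openE => x [Hx kx]; rewrite /interior.
have nHx := open_nbhs_nbhs (conj (@open_Hn R n) Hx).
by apply: filterS2 nHx (cvgr_gt _ (continuous_poisson (Hn_neq_ideal Hx)) _ kx).
Qed.

Lemma open_poisson_lt k : open [set x | Hn R n x /\ poisson xi x < k].
Proof.
rewrite openE => x [Hx kx]; rewrite /interior.
have nHx := open_nbhs_nbhs (conj (@open_Hn R n) Hx).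
by apply: filterS2 nHx (cvgr_lt _ (continuous_poisson (Hn_neq_ideal Hx)) _ kx).
Qed.

(** The horoball is the Euclidean ball with centre z = k / (1 + k) xi and
    radius 1 / (1 + k); a point of its boundary is approached from inside along
    the segment to z. *)
Lemma hclosure_horoball k : 0 < k ->
  hclosure [set x | Hn R n x /\ k < poisson xi x] =
  [set x | Hn R n x /\ k <= poisson xi x].
Proof.
move=> k0; apply/seteqP; split => x /=.
  move=> [clx Hx]; split => //; rewrite leNgt; apply/negP => Pk.
  have near_x : \forall y \near x, poisson xi y < k.
    exact: (cvgr_lt _ (continuous_poisson (Hn_neq_ideal Hx)) _ Pk).
  have [y [[_ ky] yk]] := clx _ near_x.
  by have := lt_trans ky yk; rewrite ltxx.
move=> [Hx]; rewrite le_eqVlt => /orP[/eqP Pk|Pk]; last first.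
  by split => //; apply: subset_closure.
split => // U /nbhs_dotP[e e0 eU].
have x1 := (HnE x).1 Hx; have p0 := sqr_dist_xi_gt0 xi1 x1.
have sE : 1 - dot x x = k * dot (x - xi) (x - xi).
  by rewrite Pk /poisson; field; exact: lt0r_neq0.
pose z := (k / (1 + k)) *: xi.
have k1 : 1 + k != 0 by apply: lt0r_neq0; lra.
have zz : dot (x - z) (x - z) = ((1 + k)^-1) ^+ 2.
  move: sE; rewrite sqr_dist_ideal// => sE.
  have -> : dot (x - z) (x - z) =
      ((1 + k) * dot x x - 2 * k * dot x xi + k ^+ 2 / (1 + k)) / (1 + k).
    by rewrite /z sqr_dist_scale xi1; field.
  have -> : (1 + k) * dot x x - 2 * k * dot x xi = 1 - k by lra.
  by field.
pose d := Num.min (1 / 2) (e / 2).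
have d0 : 0 < d by rewrite lt_min !divr_gt0.
have de : d <= e / 2 by rewrite ge_min lexx orbT.
have d1 : d <= 1 / 2 by rewrite ge_min lexx.
pose y := x - d *: (x - z).
have r1 : ((1 + k)^-1) ^+ 2 <= 1.
  by rewrite exprn_ile1 ?invr_ge0 ?invf_le1; lra.
have r0 : 0 < ((1 + k)^-1) ^+ 2 by rewrite exprn_gt0 ?invr_gt0; lra.
have yE : (1 - dot y y) - k * dot (y - xi) (y - xi) =
    (2 * d - d ^+ 2) / (1 + k).
  have xz : dot x (x - z) = dot x x - k / (1 + k) * dot x xi.
    by rewrite dotDr dotNr /z dotZr.
  have zxi : dot xi (x - z) = dot x xi - k / (1 + k).
    by rewrite dotDr dotNr /z dotZr xi1 mulr1 dotC.
  have yy : dot y y =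
      dot x x - 2 * d * dot x (x - z) + d ^+ 2 * dot (x - z) (x - z).
    exact: sqr_dist_scale.
  have yxi : dot y xi = dot x xi - d * dot xi (x - z).
    by rewrite /y dotDl dotNl dotZl (dotC (x - z)).
  move: sE; rewrite (sqr_dist_ideal x xi1) (sqr_dist_ideal y xi1).
  rewrite yxi yy xz zxi zz => sE.
  have -> : dot x xi = ((1 + k) * dot x x + k - 1) / (2 * k).
    rewrite (_ : (1 + k) * dot x x = 1 - k + 2 * k * dot x xi); last by lra.
    by field; exact: lt0r_neq0.
  by field; rewrite k1 lt0r_neq0.
have y0 : 0 < (1 - dot y y) - k * dot (y - xi) (y - xi).
  by rewrite yE divr_gt0//; nra.
have y1 : dot y y < 1.
  have : 0 <= k * dot (y - xi) (y - xi) by rewrite mulr_ge0 ?dot_ge0 ?ltW.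
  by lra.
exists y; split.
  split; first exact/HnE.
  by rewrite /= /poisson ltr_pdivlMr ?sqr_dist_xi_gt0//; lra.
apply: eU; have -> : y - x = - d *: (x - z) by rewrite /y addrC addKr scaleNr.
by rewrite dotZl dotZr zz; nra.
Qed.

Lemma hboundary_horoball k : 0 < k ->
  hboundary [set x | Hn R n x /\ k < poisson xi x] =
  [set x | Hn R n x /\ poisson xi x = k].
Proof.
move=> k0; rewrite /hboundary hclosure_horoball//.
rewrite ((interior_id _).1 (open_poisson_gt (k := k))).
apply/seteqP; split => x /=.
  move=> [[Hx kx] nk]; split => //; apply/eqP; rewrite eq_le kx andbT leNgt.
  by apply/negP => kx'; apply: nk.
by move=> [Hx <-]; rewrite ltxx lexx; split => // -[].
Qed.

Lemma horoball_exterior k : 0 < k ->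
  Hn R n `\` hclosure [set x | Hn R n x /\ k < poisson xi x] =
  [set x | Hn R n x /\ poisson xi x < k].
Proof.
move=> k0; rewrite hclosure_horoball//; apply/seteqP; split => x /=.
  by move=> [Hx nk]; split => //; rewrite ltNge; apply/negP => ?; apply: nk.
by move=> [Hx kx]; split => // -[_]; rewrite leNgt kx.
Qed.

Lemma hclosure_exterior k x :
  hclosure [set x | Hn R n x /\ poisson xi x < k] x ->
  Hn R n x /\ poisson xi x <= k.
Proof.
move=> [clx Hx]; split => //; rewrite leNgt; apply/negP => Pk.
have near_x : \forall y \near x, k < poisson xi y.
  exact: (cvgr_gt _ (continuous_poisson (Hn_neq_ideal Hx)) _ Pk).
have [y [[_ ky] yk]] := clx _ near_x.
by have := lt_trans ky yk; rewrite ltxx.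
Qed.

Lemma hboundary_exterior k x :
  hboundary [set x | Hn R n x /\ poisson xi x < k] x ->
  Hn R n x /\ poisson xi x = k.
Proof.
rewrite /hboundary ((interior_id _).1 (open_poisson_lt (k := k))).
move=> [/hclosure_exterior[Hx kx] nk]; split => //.
apply/eqP; rewrite eq_le kx leNgt.
by apply/negP => kx'; apply: nk.
Qed.

(** This fails in dimension 1, where horospheres are points. *)
Lemma exists_orthogonal : (2 <= n)%N -> exists2 v, v != 0 & dot v xi = 0.
Proof.
move=> n2.
have [i xii] : exists i, xi 0 i != 0.
  apply/existsP; apply: contraT; rewrite negb_exists => /forallP xi0.
  have xi_eq0 : xi = 0.
    by apply/rowP => i; rewrite mxE; apply/eqP; have := xi0 i; rewrite negbK.
  by have := oner_neq0 R; rewrite -xi1 xi_eq0 dot0l eqxx.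
have [j ji] : exists j : 'I_n, j != i.
  have [/eqP i0|i0] := eqVneq (nat_of_ord i) 0%N.
    by exists (Ordinal n2); rewrite -val_eqE /= (eqP i0).
  by exists (Ordinal (ltnW n2)); rewrite -val_eqE /= eq_sym.
exists (xi 0 i *: delta_mx 0 j - xi 0 j *: delta_mx 0 i).
  apply/eqP => /rowP/(_ j); rewrite !mxE !eqxx (negPf ji) /= mulr1 mulr0 subr0.
  by move/eqP; rewrite (negPf xii).
by rewrite dotC dotDr dotNr !dotZr !dot_delta mulrC subrr.
Qed.

(** After inversion the horosphere is a hyperplane, which goes off to infinity
    along a direction orthogonal to [xi], and infinity corresponds to [xi]. *)
Lemma horosphere_near_center k e : (2 <= n)%N -> 0 < k -> 0 < e ->
  exists y, [/\ Hn R n y, poisson xi y = k & dot (y - xi) (y - xi) < e].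
Proof.
move=> /exists_orthogonal[w w0 wxi] k0 e0; rewrite -dot_gt0 in w0.
(* As m >= 1, m^2 |w|^2 is at least m |w|^2 > 1 / e. *)
pose m := 1 + (e * dot w w)^-1.
pose v := (- (1 + k) / 2) *: xi + m *: w.
have vxi : dot v xi = - (1 + k) / 2.
  by rewrite /v dotDl !dotZl wxi xi1 mulr0 addr0 mulr1.
have [/HnE Hy Py] := poisson_inversion xi1 k0 vxi.
exists (inversion xi v); split => //; rewrite sqr_dist_inversion.
have m0 : 0 < (e * dot w w)^-1 by rewrite invr_gt0 mulr_gt0.
have vv : dot v v = (- (1 + k) / 2) ^+ 2 + m ^+ 2 * dot w w.
  by rewrite /v !dotE xi1 (dotC xi) wxi; ring.
have mw : e^-1 < dot v v.
  rewrite vv ltr_wpDl ?sqr_ge0// -ltr_pdivrMr// -invfM.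
  by rewrite /m; nra.
by rewrite -[ltRHS]invrK ltf_pV2 ?posrE ?invr_gt0// (lt_trans _ mw) ?invr_gt0.
Qed.

End Horoballs.

(** * Differentiation along coordinate directions *)

Section Directional.
Context {R : realType} {V : normedModType R}.
Implicit Types (x v : V) (u w : V -> R).

(** A directional derivative is an ordinary derivative along the line; this
    gives a chain rule that asks for no total differentiability at [x]. *)
Lemma is_derive_line x v u (du : R) :
  is_derive x v u du <-> is_derive (0 : R) 1 (fun h => u (h *: v + x)) du.
Proof.
pose l h := u (h *: v + x).
have quotE : (fun h : R => h^-1 *: ((u \o shift x) (h *: v) - u x)) =
    (fun h : R => h^-1 *: ((l \o shift 0) (h *: (1 : R)) - l 0)).
  by apply: funext => h; rewrite /l /= addr0 scale0r add0r [h *: 1]mulr1.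
have dvE : derivable u x v = derivable l 0 1.
  exact: (congr1 (fun q : R -> R => cvg (q @ 0^')) quotE).
have deE : 'D_v u x = 'D_1 l 0.
  exact: (congr1 (fun q : R -> R => lim (q @ 0^')) quotE).
by split => -[dv de]; apply: DeriveDef; rewrite -?dvE -?deE// ?dvE ?deE.
Qed.

Lemma is_derive_comp x v u (F : R -> R) (du dF : R) :
  is_derive x v u du -> is_derive (u x) 1 F dF ->
  is_derive x v (fun y => F (u y)) (dF * du).
Proof.
move=> /is_derive_line du_line dFu; apply/is_derive_line.
apply: (is_derive1_comp (f := F) (g := fun h => u (h *: v + x))) => //.
by rewrite scale0r add0r.
Qed.

Lemma is_deriveMR x v u w (du dw : R) :
  is_derive x v u du -> is_derive x v w dw ->
  is_derive x v (fun y => u y * w y) (du * w x + u x * dw).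
Proof.
move=> u' w'; rewrite addrC [du * _]mulrC.
exact: (is_deriveM u' w').
Qed.

Lemma is_deriveVR x v u (du : R) : u x != 0 ->
  is_derive x v u du -> is_derive x v (fun y => (u y)^-1) (- du / u x ^+ 2).
Proof.
move=> u0 u'; rewrite mulNr mulrC -mulNr; apply: is_derive_comp => //.
apply: is_derive_eq; first exact: (is_deriveV (f := id) u0 (is_derive_id _ _)).
by rewrite [LHS]mulr1.
Qed.

Lemma is_derive_exprn k (t : R) :
  is_derive t 1 (fun t => t ^+ k) (k%:R * t ^+ k.-1).
Proof.
have := is_deriveX k (is_derive_id t (1 : R)).
rewrite (_ : id ^+ k = (fun t => t ^+ k)); last first.
  by apply: funext => r; rewrite fctE.
by rewrite [_ *: _]mulr1.
Qed.

End Directional.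

(** * The radial equation *)

Section RadialProfile.
Context {R : realType}.
Implicit Types (a m lam t : R).

Lemma is_derive_expRN a t :
  is_derive t 1 (fun t => expR (- (a * t))) (- a * expR (- (a * t))).
Proof.
have lin : is_derive t 1 (fun t => - (a * t)) (- a).
  rewrite (_ : (fun t => _) = (- a) \*: id); last first.
    by apply: funext => r /=; rewrite -mulNr.
  by apply: is_derive_eq; rewrite scaler1.
rewrite mulrC; exact: (is_derive1_comp (is_derive_expR _) lin).
Qed.

(** In terms of the distance to the horosphere the equation becomes
    f'' + m f' + lam f = 0 with m = n - 1, whose characteristic roots are real
    and negative exactly because 0 < lam <= m^2 / 4. The decay rate in the
    double root case is halved to absorb the linear factor. *)
Lemma radial_profile m lam : 0 < m -> 0 < lam <= m ^+ 2 / 4 ->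
  exists f f' : R -> R,
    (forall t, is_derive t 1 f (f' t)) /\
    (forall t, is_derive t 1 f' (- m * f' t - lam * f t)) /\
    f 0 = 0 /\ (forall t, 0 < t -> 0 < f t) /\
    exists C d : R, [/\ 0 < C, 0 < d &
                        forall t, 0 <= t -> f t <= C * expR (- (d * t))].
Proof.
move=> m0 /andP[lam0]; rewrite le_eqVlt => /orP[/eqP lamE|lamlt].
  have h0 : 0 < m / 4 by rewrite divr_gt0.
  exists (fun t => t * expR (- (m / 2 * t))).
  exists (fun t => (1 - m / 2 * t) * expR (- (m / 2 * t))).
  split=> [t|].
    apply: (is_derive_eq
      (is_deriveMR (is_derive_id t 1) (is_derive_expRN (m / 2) t))).
    by rewrite /=; ring.
  split=> [t|].
    have lin : is_derive t 1 (fun t => 1 - m / 2 * t) (- (m / 2)).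
      by apply: is_derive_eq; rewrite /GRing.scale /=; ring.
    apply: (is_derive_eq (is_deriveMR lin (is_derive_expRN (m / 2) t))).
    by rewrite lamE; field.
  split; first by rewrite mul0r.
  split=> [t t0|]; first by rewrite mulr_gt0 ?expR_gt0.
  exists (m / 4)^-1, (m / 4); split; rewrite ?invr_gt0// => t t0.
  rewrite (_ : m / 2 * t = m / 4 * t + m / 4 * t); last by field.
  rewrite opprD expRD mulrA ler_wpM2r ?expR_ge0//.
  rewrite expRN ler_pdivrMr ?expR_gt0// ler_pdivlMl//.
  by apply: le_trans (expR_ge1Dx _); lra.
pose s := Num.sqrt (m ^+ 2 / 4 - lam).
have s0 : 0 < s by rewrite sqrtr_gt0 subr_gt0.
have sE : s ^+ 2 = m ^+ 2 / 4 - lam by rewrite sqr_sqrtr// subr_ge0 ltW.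
have sm : s < m / 2.
  by rewrite -ltr_sqr ?nnegrE ?divr_ge0 ?ltW// sE; nra.
exists (fun t => expR (- ((m / 2 - s) * t)) - expR (- ((m / 2 + s) * t))).
exists (fun t => - (m / 2 - s) * expR (- ((m / 2 - s) * t)) -
                 - (m / 2 + s) * expR (- ((m / 2 + s) * t))).
split=> [t|]; first by apply: is_deriveB; exact: is_derive_expRN.
split=> [t|].
  have d a : is_derive t 1 (fun t => - a * expR (- (a * t)))
      (a ^+ 2 * expR (- (a * t))).
    apply: (is_derive_eq
      (is_deriveMR (is_derive_cst (- a) t 1) (is_derive_expRN a t))).
    by rewrite /=; ring.
  apply: (is_derive_eq (is_deriveB (d (m / 2 - s)) (d (m / 2 + s)))).
  have lamE : lam = m ^+ 2 / 4 - s ^+ 2 by rewrite sE; ring.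
  by rewrite lamE; field.
split; first by rewrite !mulr0 subrr.
split=> [t t0|].
  by rewrite subr_gt0 ltr_expR ltrN2 ltr_pM2r//; lra.
exists 1, (m / 2 - s); split => //; first by rewrite subr_gt0.
by move=> t t0; rewrite mul1r gerBl expR_ge0.
Qed.

End RadialProfile.

Section Partials.
Context {R : realType} {n : nat}.
Implicit Types (x y v : 'rV[R]_n) (u w : 'rV[R]_n -> R) (U : set 'rV[R]_n).

Lemma is_derive_sqr_dist (a : 'rV[R]_n) x v :
  is_derive x v (fun y => dot (y - a) (y - a)) (2 * dot (x - a) v).
Proof.
apply/is_derive_line.
have -> : (fun h => dot (h *: v + x - a) (h *: v + x - a)) =
    (fun h => dot (x - a) (x - a) + h * (2 * dot (x - a) v) + h * h * dot v v).
  apply: funext => h; rewrite -addrA; move: (x - a) => X.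
  by rewrite !dotE (dotC v X); ring.
set q := 2 * dot (x - a) v.
by apply: is_derive_eq; rewrite /GRing.scale /=; ring.
Qed.

Lemma is_derive_coord i x v : is_derive x v (fun y => y 0 i) (v 0 i).
Proof.
apply/is_derive_line.
rewrite (_ : (fun h => _) = (fun h => h * v 0 i + x 0 i)); last first.
  by apply: funext => h; rewrite !mxE.
by apply: is_derive_eq; rewrite /GRing.scale /=; ring.
Qed.

Lemma is_derive_dot x v : is_derive x v (fun y => dot y y) (2 * dot x v).
Proof.
have := is_derive_sqr_dist 0 x v; rewrite subr0.
by rewrite (_ : (fun y => _) = (fun y => dot y y))//; apply: funext => y;
  rewrite subr0.
Qed.

Lemma partial_near U u (du : 'rV[R]_n -> R) i x : open U -> U x ->
  (forall y, U y -> is_derive y (delta_mx 0 i : 'rV[R]_n) u (du y)) ->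
  \forall y \near x, partial i u y = du y.
Proof.
rewrite openE => oU Ux u'; apply: filterS (oU _ Ux) => y Uy.
by case: (u' y Uy).
Qed.

Lemma near_eq_continuous_at u w x : (\forall y \near x, u y = w y) ->
  {for x, continuous w} -> {for x, continuous u}.
Proof.
move=> uw cw; have ux : u x = w x := nbhs_singleton uw.
rewrite /prop_for /continuous_at ux; apply: cvg_trans cw.
have wu : \forall y \near x, w y = u y by move: uw; apply: filterS => y ->.
exact: (near_eq_cvg wu).
Qed.

Lemma C1_onP U u (du : 'I_n -> 'rV[R]_n -> R) : open U ->
  (forall x, U x -> forall i,
    is_derive x (delta_mx 0 i : 'rV[R]_n) u (du i x) /\
    {for x, continuous (du i)}) -> C1_on U u.
Proof.
move=> oU h x Ux i; have [[d _] c] := h x Ux i; split => //.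
apply: near_eq_continuous_at c.
by apply: (partial_near oU Ux) => y Uy; have [] := h y Uy i.
Qed.

Lemma C1_on_near U u w : (forall x, U x -> \forall y \near x, u y = w y) ->
  C1_on U w -> C1_on U u.
Proof.
move=> uw cw x Ux i; have [d c] := cw x Ux i.
have uwx := uw x Ux.
have wux : \forall y \near x, w y = u y by move: uwx; apply: filterS => y ->.
split; first exact: (near_eq_derivable wux d).
apply: near_eq_continuous_at c.
apply: filterS (near_join uwx) => y uwy.
exact: near_eq_derive.
Qed.

(** Continuous formulas for the derivatives on an open set suffice: partial
    derivatives only depend on germs, so the formulas may replace them. *)
Lemma C2_onP U u (du : 'I_n -> 'rV[R]_n -> R)
    (d2u : 'I_n -> 'I_n -> 'rV[R]_n -> R) : open U ->
  (forall x, U x -> forall i,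
    is_derive x (delta_mx 0 i : 'rV[R]_n) u (du i x) /\
    {for x, continuous (du i)}) ->
  (forall x, U x -> forall i j,
    is_derive x (delta_mx 0 j : 'rV[R]_n) (du i) (d2u i j x) /\
    {for x, continuous (d2u i j)}) -> C2_on U u.
Proof.
move=> oU u1 u2; split; first exact: C1_onP u1.
move=> i; apply: (@C1_on_near _ _ (du i)).
  by move=> x Ux; apply: (partial_near oU Ux) => y Uy; have [] := u1 y Uy i.
by apply: (C1_onP oU (du := d2u i)) => x Ux j; exact: u2.
Qed.

(** With the conformal factor s = 2 / (1 - |x|^2), the flux in the divergence
    form of the Laplacian is s^(n - 2) times the Euclidean gradient; the first
    order term comes from the derivative of this power. *)
Lemma hlaplacianE u (du : 'I_n -> 'rV[R]_n -> R) (d2u : 'I_n -> R) x :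
  (2 <= n)%N -> Hn R n x ->
  (forall i, \forall y \near x,
    is_derive y (delta_mx 0 i : 'rV[R]_n) u (du i y)) ->
  (forall i, is_derive x (delta_mx 0 i : 'rV[R]_n) (du i) (d2u i)) ->
  hlaplacian u x = ((1 - dot x x) / 2) ^+ 2 * (\sum_i d2u i) +
    (n%:R - 2) * ((1 - dot x x) / 2) * \sum_i x 0 i * du i x.
Proof.
move=> n2 Hx u1 u2.
pose sg (y : 'rV[R]_n) := 2 / (1 - dot y y).
have sg0 y : Hn R n y -> 0 < sg y.
  by move=> /HnE y1; rewrite divr_gt0// subr_gt0.
have detE y : Hn R n y -> Num.sqrt (\det (poincare_metric y)) = sg y ^+ n.
  move=> Hy; rewrite /poincare_metric det_scalar sqr_enorm -/(sg y).
  by rewrite exprAC sqrtr_sqr ger0_norm ?exprn_ge0 ?ltW// sg0.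
have nHx := open_nbhs_nbhs (conj (@open_Hn R n) Hx).
have flux i : \forall y \near x, sg y ^+ (n - 2) * du i y =
    Num.sqrt (\det (poincare_metric y)) *
      \sum_j invmx (poincare_metric y) i j * partial j u y.
  apply: filterS2 nHx (u1 i) => y Hy dui; rewrite detE//.
  rewrite (bigD1 i) //= big1 ?addr0 => [|j ji].
    rewrite /poincare_metric invmx_scalar !mxE eqxx mulr1n sqr_enorm -/(sg y).
    case: dui => _; rewrite /partial => ->.
    by rewrite -{2}(subnK n2) exprD mulrA mulfK// expf_neq0// lt0r_neq0// sg0.
  by rewrite /poincare_metric invmx_scalar !mxE eq_sym (negPf ji) mulr0n mul0r.
have dsg i : is_derive x (delta_mx 0 i : 'rV[R]_n) sg (sg x ^+ 2 * x 0 i).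
  have x0 : 1 - dot x x != 0 by rewrite lt0r_neq0// subr_gt0; exact/HnE.
  have d1 : is_derive x (delta_mx 0 i : 'rV[R]_n) (fun y => 1 - dot y y)
      (- (2 * x 0 i)).
    apply: (is_derive_eq (is_deriveB (is_derive_cst (1 : R) x _)
      (is_derive_dot x (delta_mx 0 i)))).
    by rewrite dot_delta sub0r.
  have d2 := is_deriveMR (is_derive_cst (2 : R) x _)
    (is_deriveVR (u := fun y => 1 - dot y y) x0 d1).
  by apply: (is_derive_eq d2); rewrite /sg /=; field.
have dflux i : partial i (fun y => Num.sqrt (\det (poincare_metric y)) *
    \sum_j invmx (poincare_metric y) i j * partial j u y) x =
    sg x ^+ (n - 2) * ((n - 2)%:R * sg x * (x 0 i * du i x) + d2u i).
  have := near_eq_is_derive (flux i)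
    (is_deriveMR (is_derive_comp (dsg i) (is_derive_exprn (n - 2) (sg x)))
                 (u2 i)).
  case => _; rewrite /partial => ->.
  move: (sg x) (n - 2)%N => s [|k] /=; first by ring.
  by rewrite [s ^+ k.+1]exprS; ring.
rewrite /hlaplacian /laplace_beltrami detE//.
rewrite (eq_bigr _ (fun i _ => dflux i)) -mulr_sumr big_split /= -mulr_sumr.
have sx := sg0 _ Hx.
rewrite -{1}(subnK n2) exprD natrB//.
have -> : (1 - dot x x) / 2 = (sg x)^-1 by rewrite invf_div.
have := expf_neq0 (n - 2) (lt0r_neq0 sx).
move: (sg x ^+ (n - 2)) => A A0.
by field; rewrite A0 lt0r_neq0.
Qed.

End Partials.

(** * Functions of the distance to a horosphere *)

Section BusemannCalculus.
Context {R : realType} {n : nat} (xi : 'rV[R]_n) (xi1 : dot xi xi = 1).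
Implicit Types (x y v : 'rV[R]_n) (i j : 'I_n).

(** The Busemann function in closed form: this expression is differentiated,
    instead of the limit. *)
Definition busemann_formula x : R := - ln (poisson xi x).

Definition dbusemann i x : R :=
  2 * (x 0 i - xi 0 i) / dot (x - xi) (x - xi) + 2 * x 0 i / (1 - dot x x).

Definition d2busemann i j x : R :=
  2 * (i == j)%:R / dot (x - xi) (x - xi)
  - 4 * (x 0 i - xi 0 i) * (x 0 j - xi 0 j) / dot (x - xi) (x - xi) ^+ 2
  + 2 * (i == j)%:R / (1 - dot x x)
  + 4 * x 0 i * x 0 j / (1 - dot x x) ^+ 2.

Let p_neq0 x : Hn R n x -> dot (x - xi) (x - xi) != 0.
Proof. by move=> /HnE /(sqr_dist_xi_gt0 xi1) /lt0r_neq0. Qed.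

Let s_neq0 x : Hn R n x -> 1 - dot x x != 0.
Proof. by move=> /HnE x1; rewrite lt0r_neq0// subr_gt0. Qed.

Let is_derive_s x v :
  is_derive x v (fun y => 1 - dot y y) (- (2 * dot x v)).
Proof.
by apply: (is_derive_eq (is_deriveB (is_derive_cst (1 : R) x v)
  (is_derive_dot x v))); rewrite sub0r.
Qed.

Lemma is_derive_busemann_formula i x : Hn R n x ->
  is_derive x (delta_mx 0 i : 'rV[R]_n) busemann_formula (dbusemann i x).
Proof.
move=> Hx; have p0 := p_neq0 Hx; have s0 := s_neq0 Hx.
have dP := is_deriveMR (is_derive_s x (delta_mx 0 i))
  (is_deriveVR (u := fun y => dot (y - xi) (y - xi)) p0
     (is_derive_sqr_dist xi x (delta_mx 0 i))).
have P0 := poisson_gt0 xi1 ((HnE x).1 Hx).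
apply: (is_derive_eq (is_deriveN (is_derive_comp dP (is_derive1_ln P0)))).
rewrite !dot_delta /poisson /dbusemann !mxE; field.
by rewrite p0 s0.
Qed.

Lemma is_derive_dbusemann i j x : Hn R n x ->
  is_derive x (delta_mx 0 j : 'rV[R]_n) (dbusemann i) (d2busemann i j x).
Proof.
move=> Hx; have p0 := p_neq0 Hx; have s0 := s_neq0 Hx.
pose e : 'rV[R]_n := delta_mx 0 j.
have eE : e 0 i = (i == j)%:R by rewrite mxE.
have dc : is_derive x e (fun y => 2 * y 0 i) (2 * (i == j)%:R).
  apply: (is_derive_eq (is_deriveMR (is_derive_cst (2 : R) x e)
    (is_derive_coord i x e))).
  by rewrite mul0r add0r eE.
have dX : is_derive x e (fun y => 2 * (y 0 i - xi 0 i)) (2 * (i == j)%:R).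
  apply: (is_derive_eq (is_deriveMR (is_derive_cst (2 : R) x e)
    (is_deriveB (is_derive_coord i x e) (is_derive_cst (xi 0 i) x e)))).
  by rewrite mul0r add0r eE subr0.
have d := is_deriveD
  (is_deriveMR dX (is_deriveVR (u := fun y => dot (y - xi) (y - xi)) p0
     (is_derive_sqr_dist xi x e)))
  (is_deriveMR dc (is_deriveVR (u := fun y => 1 - dot y y) s0
     (is_derive_s x e))).
apply: (is_derive_eq d); rewrite !dot_delta /d2busemann !mxE; field.
by rewrite p0 s0.
Qed.

Let continuous_p x : Hn R n x ->
  {for x, continuous (fun y => (dot (y - xi) (y - xi))^-1)}.
Proof.
by move=> /p_neq0 p0; apply: continuousV => //; exact: continuous_sqr_dist.
Qed.

Let continuous_s x : Hn R n x ->
  {for x, continuous (fun y => (1 - dot y y)^-1)}.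
Proof.
move=> /s_neq0 s0; apply: continuousV => //.
by apply: continuousB; [exact: cst_continuous|exact: continuous_dot].
Qed.

Let continuous_coordB i x : {for x, continuous (fun y => y 0 i - xi 0 i)}.
Proof.
by apply: continuousB; [exact: continuous_coord|exact: cst_continuous].
Qed.

Lemma continuous_busemann_formula x : Hn R n x ->
  {for x, continuous busemann_formula}.
Proof.
move=> Hx; apply: continuousN; apply: continuous_comp.
  exact: continuous_poisson (Hn_neq_ideal xi1 Hx).
by apply: continuous_ln; apply: poisson_gt0 => //; exact/HnE.
Qed.

Lemma continuous_dbusemann i x : Hn R n x ->
  {for x, continuous (dbusemann i)}.
Proof.
move=> Hx; apply: continuousD; apply: continuousM.
- by apply: continuousM; [exact: cst_continuous|exact: continuous_coordB].
- exact: continuous_p.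
- by apply: continuousM; [exact: cst_continuous|exact: continuous_coord].
- exact: continuous_s.
Qed.

Lemma continuous_d2busemann i j x : Hn R n x ->
  {for x, continuous (d2busemann i j)}.
Proof.
move=> Hx.
have -> : d2busemann i j = (fun x : 'rV[R]_n =>
  2 * (i == j)%:R * (dot (x - xi) (x - xi))^-1
  - 4 * (x 0 i - xi 0 i) * (x 0 j - xi 0 j) *
    ((dot (x - xi) (x - xi))^-1 * (dot (x - xi) (x - xi))^-1)
  + 2 * (i == j)%:R * (1 - dot x x)^-1
  + 4 * x 0 i * x 0 j * ((1 - dot x x)^-1 * (1 - dot x x)^-1)).
  by apply: funext => y; rewrite /d2busemann !expr2 !invfM.
have cp := continuous_p Hx; have cs := continuous_s Hx.
have c4 (g h : 'rV[R]_n -> R) :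
    {for x, continuous g} -> {for x, continuous h} ->
    {for x, continuous (fun y => 4 * g y * h y)}.
  move=> cg ch; apply: continuousM => //; apply: continuousM => //.
  exact: cst_continuous.
apply: continuousD; last first.
  apply: continuousM; last exact: continuousM.
  by apply: c4; exact: continuous_coord.
apply: continuousD; last first.
  by apply: continuousM => //; exact: cst_continuous.
apply: continuousB.
  by apply: continuousM => //; exact: cst_continuous.
by apply: continuousM; [apply: c4; exact: continuous_coordB|exact: continuousM].
Qed.

Let dbusemann_vec i x :
  dbusemann i x = ((2 / dot (x - xi) (x - xi)) *: (x - xi) +
                      (2 / (1 - dot x x)) *: x) 0 i.
Proof. by rewrite !mxE /dbusemann; congr (_ + _); rewrite mulrAC. Qed.

Let dot_shift x :
  dot x (x - xi) = (dot (x - xi) (x - xi) - (1 - dot x x)) / 2.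
Proof. by rewrite sqr_dist_ideal// dotDr dotNr; field. Qed.

(** The left-hand side is the squared norm of the gradient for the hyperbolic
    metric, which is 1 for a distance function. *)
Lemma norm_grad_busemann x : Hn R n x ->
  ((1 - dot x x) / 2) ^+ 2 * \sum_i dbusemann i x ^+ 2 = 1.
Proof.
move=> Hx; have p0 := p_neq0 Hx; have s0 := s_neq0 Hx.
under eq_bigr do rewrite expr2 !dbusemann_vec.
rewrite -/(dot _ _) sqr_dot_comb (dotC (x - xi) x) dot_shift.
move: p0 s0; move: (dot (x - xi) _) => p p0.
move: (dot x x) => q q0; field.
by rewrite p0 q0.
Qed.

(** The left-hand side is the hyperbolic Laplacian of the Busemann function,
    the mean curvature of the horospheres, which are all congruent. *)
Lemma laplace_busemann x : Hn R n x ->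
  ((1 - dot x x) / 2) ^+ 2 * (\sum_i d2busemann i i x) +
  (n%:R - 2) * ((1 - dot x x) / 2) * \sum_i x 0 i * dbusemann i x = n%:R - 1.
Proof.
move=> Hx; have p0 := p_neq0 Hx; have s0 := s_neq0 Hx.
under [X in _ + _ * X]eq_bigr do rewrite dbusemann_vec.
rewrite -/(dot _ _).
have -> : \sum_i d2busemann i i x =
    n%:R * (2 / dot (x - xi) (x - xi) + 2 / (1 - dot x x)) -
    4 / dot (x - xi) (x - xi) ^+ 2 * dot (x - xi) (x - xi) +
    4 / (1 - dot x x) ^+ 2 * dot x x.
  have sum3 (a b c : R) (y z : 'rV[R]_n) :
      \sum_i (a + b * (y 0 i * y 0 i) + c * (z 0 i * z 0 i)) =
      n%:R * a + b * dot y y + c * dot z z.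
    by rewrite !big_split /= sumr_const card_ord -!mulr_sumr mulr_natl.
  rewrite -mulNr -sum3; apply: eq_bigr => i _.
  rewrite /d2busemann eqxx mulr1n !mxE; field.
  by rewrite p0 s0.
rewrite [dot x (_ *: _ + _)]dotDr !dotZr dot_shift.
move: p0 s0; move: (dot (x - xi) _) => p p0.
move: (dot x x) => q q0; field.
by rewrite p0 q0.
Qed.

End BusemannCalculus.

Section RadialFunctions.
Context {R : realType} {n : nat} (xi : 'rV[R]_n) (xi1 : dot xi xi = 1).
Context (f f' : R -> R) (m lam c : R).
Context (df : forall t : R, is_derive t 1 f (f' t)).
Context (df' : forall t : R, is_derive t 1 f' (- m * f' t - lam * f t)).
Implicit Types (x : 'rV[R]_n) (i j : 'I_n).

Let b x : R := busemann_formula xi x - c.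
Let f'' t : R := - m * f' t - lam * f t.

Let continuous_derivable (g g' : R -> R) (t : R) :
  (forall t : R, is_derive t 1 g (g' t)) -> {for t, continuous g}.
Proof.
move=> dg; apply: differentiable_continuous; apply/derivable1_diffP.
by case: (dg t).
Qed.

Let continuous_b (g : R -> R) x : {for b x, continuous g} -> Hn R n x ->
  {for x, continuous (fun y => g (b y))}.
Proof.
move=> cg Hx; apply: (@continuous_comp _ _ _ b g) => //.
apply: continuousB; first exact: continuous_busemann_formula.
exact: cst_continuous.
Qed.

Let is_derive_b i x : Hn R n x ->
  is_derive x (delta_mx 0 i : 'rV[R]_n) b (dbusemann xi i x).
Proof.
move=> Hx; apply: (is_derive_eq (is_deriveB
  (is_derive_busemann_formula xi1 i Hx)(is_derive_cst c x _))).
by rewrite subr0.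
Qed.

Let du i x : R := f' (b x) * dbusemann xi i x.
Let d2u i j x : R :=
  f'' (b x) * dbusemann xi j x * dbusemann xi i x +
  f' (b x) * d2busemann xi i j x.

Let is_derive_u i x : Hn R n x ->
  is_derive x (delta_mx 0 i : 'rV[R]_n) (fun y => f (b y)) (du i x).
Proof. by move=> Hx; apply: is_derive_comp; first exact: is_derive_b. Qed.

Let is_derive_du i j x : Hn R n x ->
  is_derive x (delta_mx 0 j : 'rV[R]_n) (du i) (d2u i j x).
Proof.
move=> Hx; apply: is_deriveMR; last exact: is_derive_dbusemann.
by apply: is_derive_comp; first exact: is_derive_b.
Qed.

Lemma continuous_radial x : Hn R n x -> {for x, continuous (fun y => f (b y))}.
Proof. by apply: continuous_b; exact: continuous_derivable df. Qed.

Lemma C2_on_radial U : open U -> U `<=` Hn R n -> C2_on U (fun y => f (b y)).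
Proof.
move=> oU UH; have cf t : {for t, continuous f} := continuous_derivable df.
have cf' t : {for t, continuous f'} := continuous_derivable df'.
have cf'' t : {for t, continuous f''}.
  apply: continuousB; apply: continuousM => //; exact: cst_continuous.
apply: (@C2_onP _ _ _ _ du d2u) => // x /UH Hx i.
  split; first exact: is_derive_u.
  by apply: continuousM; [exact: continuous_b|exact: continuous_dbusemann].
move=> j; split; first exact: is_derive_du.
apply: continuousD; apply: continuousM.
- by apply: continuousM; [exact: continuous_b|exact: continuous_dbusemann].
- exact: continuous_dbusemann.
- exact: continuous_b.
- exact: continuous_d2busemann.
Qed.

(** The Laplacian of f(b) is f''(b) |grad b|^2 + f'(b) Lap b, where the gradient
    has norm 1 and Lap b = n - 1, so the equation reduces to that of f. *)
Lemma hlaplacian_radial x : (2 <= n)%N -> m = n%:R - 1 -> Hn R n x ->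
  hlaplacian (fun y => f (b y)) x = - lam * f (b x).
Proof.
move=> n2 mE Hx.
have du_near i : \forall y \near x,
    is_derive y (delta_mx 0 i : 'rV[R]_n) (fun y => f (b y)) (du i y).
  apply: filterS (open_nbhs_nbhs (conj (@open_Hn R n) Hx)) => y Hy.
  exact: is_derive_u.
rewrite (hlaplacianE n2 Hx du_near (fun i => is_derive_du i i Hx)).
have -> : \sum_i x 0 i * du i x =
    f' (b x) * \sum_i x 0 i * dbusemann xi i x.
  by rewrite mulr_sumr; apply: eq_bigr => i _; rewrite /du mulrCA.
have -> : \sum_i d2u i i x = f'' (b x) * (\sum_i dbusemann xi i x ^+ 2) +
    f' (b x) * \sum_i d2busemann xi i i x.
  rewrite !mulr_sumr -big_split; apply: eq_bigr => i _.
  by rewrite /d2u -mulrA -expr2.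
have grad := norm_grad_busemann xi1 Hx.
have lap := laplace_busemann xi1 Hx; rewrite -mE in lap.
move: grad lap; set S2 := \sum_i dbusemann xi i x ^+ 2.
set L := \sum_i d2busemann xi i i x.
set S1 := \sum_i _ * _ => grad lap.
transitivity (f'' (b x) * (((1 - dot x x) / 2) ^+ 2 * S2) + f' (b x) *
  (((1 - dot x x) / 2) ^+ 2 * L + (n%:R - 2) * ((1 - dot x x) / 2) * S1)).
  by ring.
by rewrite grad lap /f''; ring.
Qed.

End RadialFunctions.

Theorem proposition4p3 (R : realType) (n : nat) (hn : (2 <= n)%N)
  (B : set 'rV[R]_n) (hB : is_open_horoball B)
  (lam : R) (hlam : 0 < lam <= lambda1 R n) :
  let H := hboundary B in
  let Omega := Hn R n `\` hclosure B in
  exists u : 'rV[R]_n -> R,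
    ({within hclosure Omega, continuous u} /\ C2_on Omega u) /\
    (forall x, Omega x -> - hlaplacian u x = lam * u x) /\
    (forall x, hboundary Omega x -> u x = 0) /\
    (forall x, Omega x -> 0 < u x) /\
    (exists M : R, forall x, Omega x -> `|u x| <= M) /\
    (exists f : R -> R, forall x, hclosure Omega x -> u x = f (hdist_set x H)) /\
    (exists v : 'rV[R]_n -> R,
      [/\ forall x, hclosure Omega x -> v x = u x,
          forall xi, (ideal_boundary R n `\` asymptotic_boundary H) xi ->
            v xi = 0
        & cone_continuous_on
            (hclosure Omega `|`
             (ideal_boundary R n `\` asymptotic_boundary H)) v]) /\
    ~ (exists v : 'rV[R]_n -> R,
        (forall x, hclosure Omega x -> v x = u x) /\
        cone_continuous_on (hclosure Omega `|` asymptotic_boundary H) v).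
Proof.
have [xi [c [xi_ideal BE]]] := hB.
have xi1 := (ideal_boundaryE xi).1 xi_ideal.
pose k := expR (- c); have k0 : 0 < k := expR_gt0 _.
have lnk : ln k = - c by rewrite /k expRK.
have {}BE : B = [set x | Hn R n x /\ k < poisson xi x].
  rewrite BE; apply/seteqP; split => x /= [Hx h]; split => //.
    move: h; rewrite busemannE//; last exact/HnE.
    rewrite ltrNl -lnk ltr_ln ?posrE ?poisson_gt0//; exact/HnE.
  rewrite busemannE//; last exact/HnE.
  rewrite ltrNl -lnk ltr_ln ?posrE ?poisson_gt0//; exact/HnE.
have [f [f' [df [df' [f0 [fpos [C [d [C0 d0 fle]]]]]]]]] :
    exists f f' : R -> R,
    (forall t : R, is_derive t 1 f (f' t)) /\
    (forall t : R, is_derive t 1 f' (- (n%:R - 1) * f' t - lam * f t)) /\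
    f 0 = 0 /\ (forall t, 0 < t -> 0 < f t) /\
    exists C d : R, [/\ 0 < C, 0 < d &
                        forall t, 0 <= t -> f t <= C * expR (- (d * t))].
  by apply: radial_profile => //; rewrite subr_gt0 ltr1n.
move=> H Omega.
have HE : H = [set x | Hn R n x /\ poisson xi x = k].
  by rewrite /H BE hboundary_horoball.
have OE : Omega = [set x | Hn R n x /\ poisson xi x < k].
  by rewrite /Omega BE horoball_exterior.
have clO x : hclosure Omega x -> Hn R n x /\ poisson xi x <= k.
  by rewrite OE; exact: hclosure_exterior.
pose b x := busemann_formula xi x - c; pose u x := f (b x).
have bE x : b x = ln k - ln (poisson xi x) by rewrite lnk addrC.
have b_gt0 x : Omega x -> 0 < b x.
  rewrite OE => -[Hx Pk]; rewrite bE subr_gt0 ltr_ln ?posrE//.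
  by apply: poisson_gt0 => //; exact/HnE.
have b_ge0 x : hclosure Omega x -> 0 <= b x.
  move=> /clO[Hx Pk]; rewrite bE subr_ge0 ler_ln ?posrE//.
  by apply: poisson_gt0 => //; exact/HnE.
have f_ge0 t : 0 <= t -> 0 <= f t.
  by rewrite le_eqVlt => /orP[/eqP<-|/fpos/ltW//]; rewrite f0.
(* [xi] is a limit point of every level set of the distance to [H], so all
   values of the profile are taken arbitrarily close to it. *)
have near_xi a e : 0 <= a -> 0 < e ->
    exists y, [/\ Hn R n y, b y = a & dot (y - xi) (y - xi) < e].
  move=> a0 e0; have [y [Hy Py ye]] := horosphere_near_center xi1 hn
    (expR_gt0 (- (c + a))) e0.
  by exists y; split => //; rewrite /b /busemann_formula Py expRK; ring.
have H_ideal : asymptotic_boundary H xi.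
  split => // U U_xi.
  have /nbhs_dotP[e e0 eU] : nbhs xi [set w | dot w w <= 1 -> U w].
    by apply: cone_nbhs_closed_ball => //; rewrite xi1.
  have [y [Hy by0 ye]] := near_xi 0 e (lexx 0) e0.
  exists y; split; last by apply: (eU _ ye); apply/ltW/HnE.
  rewrite HE; split => //; apply: ln_inj; rewrite ?posrE//.
    by apply: poisson_gt0 => //; exact/HnE.
  by apply/esym/eqP; rewrite -subr_eq0 -bE by0.
(* exp (d t) >= 1 + d t turns the exponential bound into an explicit time. *)
have decay e : 0 < e -> exists2 T, 0 < T & forall t, T <= t -> f t < e.
  move=> e0; exists (1 + C / (d * e)).
    by rewrite ltr_wpDr// divr_ge0 ?mulr_ge0 ?ltW.
  move=> t Tt; have t0 : 0 <= t.
    by apply: le_trans Tt; rewrite addr_ge0// divr_ge0 ?mulr_ge0 ?ltW.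
  apply: le_lt_trans (fle _ t0) _.
  rewrite expRN ltr_pdivrMr ?expR_gt0//.
  apply: (@lt_le_trans _ _ (e * (1 + d * t))); last first.
    by rewrite ler_wpM2l ?expR_ge1Dx// ltW.
  have : d * (1 + C / (d * e)) <= d * t by rewrite ler_wpM2l// ltW.
  have -> : d * (1 + C / (d * e)) = d + C / e by field; rewrite !lt0r_neq0.
  move=> dt; apply: (@lt_le_trans _ _ (e * (d + C / e))).
    by rewrite mulrDr mulrCA mulfV ?lt0r_neq0// mulr1 ltrDr mulr_gt0.
  by rewrite ler_wpM2l ?(ltW e0)//; lra.
exists u.
split; [split|split; [|split; [|split; [|split; [|split; [|split]]]]]].
- apply: continuous_in_subspaceT => x /set_mem /clO[Hx _].
  exact: (continuous_radial xi1 df Hx).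
- apply: (C2_on_radial xi1 c df df').
    by rewrite OE; exact: open_poisson_lt.
  by rewrite OE => x [].
- move=> x; rewrite OE => -[Hx _].
  by rewrite (hlaplacian_radial xi1 c df df')// mulNr opprK.
- move=> x; rewrite OE => /hboundary_exterior -/(_ xi1)[Hx Pk].
  by rewrite /u bE Pk subrr f0.
- by move=> x /b_gt0 /fpos.
- exists C => x Ox; have bx := b_gt0 x Ox.
  rewrite gtr0_norm ?fpos//; apply: le_trans (fle _ (ltW bx)) _.
  by rewrite ler_piMr ?(ltW C0)// expR_le1 oppr_le0 mulr_ge0 ?ltW.
- exists f => x /clO[Hx Pk]; rewrite HE hdist_horosphere//; last exact/HnE.
  by rewrite /u bE.
- pose v x := if dot x x < 1 then u x else 0.
  have vu x : Hn R n x -> v x = u x by move=> /HnE x1; rewrite /v x1.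
  have v0 x : ideal_boundary R n x -> v x = 0.
    by move=> /ideal_boundaryE x1; rewrite /v x1 ltxx.
  exists v; split => [x /clO[Hx _]|x [+ _]|z Dz]; [exact: vu|exact: v0|].
  have D_ball w : (hclosure Omega `|`
      (ideal_boundary R n `\` asymptotic_boundary H)) w -> dot w w <= 1.
    by move=> [/clO[/HnE/ltW]|[/ideal_boundaryE->]].
  rewrite within_cone_nbhs//; last exact: D_ball.
  case: Dz => [/clO[Hz _]|[z_ideal zH]].
    have cz : {for z, continuous v}.
      apply: (@near_eq_continuous_at _ _ _ u).
        apply: filterS (open_nbhs_nbhs (conj (@open_Hn R n) Hz)) => y Hy.
        exact: vu.
      exact: (continuous_radial xi1 df Hz).
    by apply: cvg_trans cz; apply: cvg_app; exact: cvg_within.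
  have zxi : z != xi by apply: contra_not_neq zH => ->.
  rewrite v0//; apply/cvgrPdist_lt => e e0.
  have [T T0 fT] := decay e e0.
  have Pz : poisson xi z < expR (- (T + c)).
    by rewrite /poisson ((ideal_boundaryE z).1 z_ideal) subrr mul0r expR_gt0.
  have : \forall w \near z, poisson xi w < expR (- (T + c)).
    exact: (cvgr_lt _ (continuous_poisson zxi) _ Pz).
  rewrite /within /prop_near1 /=; apply: filterS => w Pw Dw.
  case: Dw => [wO|[w_ideal _]]; last by rewrite v0// subrr normr0.
  have [Hw _] := clO w wO.
  rewrite vu// sub0r normrN ger0_norm ?f_ge0 ?b_ge0//; apply: fT.
  have P0 : 0 < poisson xi w by apply: poisson_gt0 => //; exact/HnE.
  rewrite bE lnk; move: Pw; rewrite -ltr_ln ?posrE ?expR_gt0// expRK.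
  by lra.
- move=> [v [vu v_cont]].
  have D_ball w : (hclosure Omega `|` asymptotic_boundary H) w -> dot w w <= 1.
    by move=> [/clO[/HnE/ltW]|[/ideal_boundaryE->]].
  have := v_cont xi (or_intror H_ideal).
  rewrite within_cone_nbhs ?xi1// => v_lim.
  (* Continuity at [xi] would make the profile constant on t > 0. *)
  have v_xi a : 0 < a -> v xi = f a.
    move=> a0; apply/eqP; rewrite -subr_eq0 -normr_eq0; apply/negPn/negP => ne0.
    have e0 : 0 < `|v xi - f a| by rewrite lt_def ne0 normr_ge0.
    have /cvgrPdist_lt/(_ _ e0) := v_lim.
    rewrite /within /prop_near1 /= => /nbhs_dotP[r r0 near_v].
    have [y [Hy ya yr]] := near_xi a r (ltW a0) r0.
    have P0 : 0 < poisson xi y by apply: poisson_gt0 => //; exact/HnE.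
    have yO : hclosure Omega y.
      split => //; apply: subset_closure; rewrite OE; split => //.
      by rewrite -ltr_ln ?posrE// -subr_gt0 -bE ya.
    have vy : v y = f a by rewrite -ya; exact: vu.
    by have := near_v y yr (or_introl yO); rewrite vy ltxx.
  have f1 := fpos 1 ltr01; have [T T0 fT] := decay _ f1.
  by have := fT T (lexx T); rewrite -(v_xi T T0) (v_xi 1 ltr01) ltxx.
Qed.
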